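(* Let $V$ be an irreducible $G$-module and let $E$ be a $G$-invariant $V$-embedded vector bundle on $X$, where $X$ has irreducible components $X_1,\ldots,X_k$ and $E$ has rank $N_i$ on $X_i$ for $i=1,\ldots,k$, ordered such that $N_1\ge\ldots\ge N_k$. Assume that $\alpha=(\alpha_1,\ldots,\alpha_k)\in\mathbb{N}_0^k$ is such that for every $i=1,\ldots,k$ $$\alpha_1N_1+\ldots+\alpha_iN_i+N_1(N_i-1)<\dim V.$$ Then $E$ is $\alpha$-nondefective.
   Context: All varieties are over $\mathbb{C}$. $G$ is a group, $V$ is a finite-dimensional $G$-module, and $X$ is a (quasi-)affine cone which lies in some $G$-module and is closed under the $G$-action. A $V$-embedded vector bundle $E$ on $X$ is an algebraic vector bundle $\pi\colon E\to X$ (Zariski-locally trivial) all of whose fibers $E_x=\pi^{-1}(\{x\})$, $x\in X$, are linear subspaces of $V$. Its fiber dimension is constant on each irreducible component $X_i$ and is called the rank $N_i$ of $E$ on $X_i$. $E$ is $G$-invariant (equivalently, $G$-equivariant) if $E_{gx}=gE_x$ for all $g\in G$, $x\in X$. A $G$-module is irreducible if it is nonzero and has no proper nonzero $G$-submodule. For $\alpha\in\mathbb{N}_0^k$ write $|\alpha|=\alpha_1+\ldots+\alpha_k$. A sequence $x=(x_1,\ldots,x_r)$ of points of $X$ is of (component) type $\alpha$ if exactly $\alpha_i$ of the $x_j$ lie in $X_i$ for each $i$ and no $x_j$ lies in the intersection of two components (so $r=|\alpha|$). It is a general sequence of type $\alpha$ if, in addition, each $x_j$ is a general point of one of the components. $E$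 is $\alpha$-nondefective if for a general sequence $x_1,\ldots,x_r$ of type $\alpha$ the linear span $\langle E_{x_1},\ldots,E_{x_r}\rangle\subseteq V$ has dimension $\alpha_1N_1+\ldots+\alpha_kN_k$.
   Formalization: Each irreducible component X_i is additionally assumed to be closed under the G-action (automatic for X irreducible or G connected algebraic); if G may permute the components, the claim fails, e.g. for the monomial group on the three axes of C^3 minus the origin with α=(2,0,0). *)

(* Defs.v *)
From HB Require Import structures.
From mathcomp Require Import all_boot all_order all_algebra all_fingroup.
From mathcomp Require Import boolp classical_sets reals.
From mathcomp Require Import complex mpoly.

Set Implicit Arguments.
Unset Strict Implicit.
Unset Printing Implicit Defensive.

Import Order.TTheory GRing.Theory Num.Theory.
Local Open Scope ring_scope.
Local Open Scope classical_set_scope.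

Section Zariski.
Variables (K : fieldType) (W : vectType K).
Implicit Types (p q : {mpoly K[\dim {:W}]}) (A X Y : set W).

(* Polynomial functions on W are polynomials in the coordinates with respect
   to one fixed basis; a linear change of coordinates maps polynomials to
   polynomials, so nothing below depends on that basis. *)
Definition peval p (w : W) : K :=
  p.@[fun i => coord (vbasis {:W}) i w].

Definition zclosed A : Prop :=
  exists I : set {mpoly K[\dim {:W}]},
    A = [set w | forall p, I p -> peval p w = 0].

Definition zopen A : Prop := zclosed (~` A).

Definition zopen_in X A : Prop := exists2 O, zopen O & A = X `&` O.

Definition zdense_in X A : Prop :=
  A `<=` X /\
  forall O, zopen O -> (X `&` O) !=set0 -> (A `&` O) !=set0.

(* P holds for a general point of X. *)
Definition generally_on X (P : set W) : Prop :=
  exists A, [/\ zopen_in X A, zdense_in X A & A `<=` P].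

Definition zirreducible X : Prop :=
  X !=set0 /\
  forall A B, zclosed A -> zclosed B -> X `<=` A `|` B ->
    X `<=` A \/ X `<=` B.

Definition irreducible_component X Y : Prop :=
  [/\ Y `<=` X, zirreducible Y
    & forall Z, zirreducible Z -> Y `<=` Z -> Z `<=` X -> Z = Y].

(* X_ enumerates the irreducible components of X without repetition. *)
Definition irreducible_components (I : Type) X (X_ : I -> set W) : Prop :=
  injective X_ /\
  forall Y, irreducible_component X Y <-> exists i, Y = X_ i.

Definition quasi_affine X : Prop :=
  exists A O, [/\ zclosed A, zopen O & X = A `&` O].

(* Scaling by 0 is excluded: a quasi-affine cone need not contain the origin,
   and a nonempty closed set that is stable under nonzero scalars does. *)
Definition quasi_affine_cone X : Prop :=
  quasi_affine X /\ forall (a : K) x, a != 0 -> X x -> X (a *: x).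

Definition regular_fun A (f : W -> K) : Prop :=
  forall w, A w -> exists O p q, [/\ zopen O, O w &
    forall u, A u -> O u -> peval q u != 0 /\ f u = peval p u / peval q u].

End Zariski.

Definition regular_map (K : fieldType) (W W' : vectType K) (A : set W)
    (f : W -> W') : Prop :=
  forall i, regular_fun A (fun w => coord (vbasis {:W'}) i (f w)).

Section Bundles.
Variables (K : fieldType) (W V : vectType K).
Implicit Types (X U : set W) (E : W -> {vspace V}).

(* The part of the total space of E that lies over U, inside W x V. *)
Definition total_space U E : set (W * V) :=
  [set z | U z.1 /\ z.2 \in E z.1].

(* phi and psi are mutually inverse isomorphisms over U between U x K^r and
   the total space of E over U, linear on the fibers. *)
Definition trivialization U E (r : nat)
    (phi : W * 'rV[K]_r -> W * V) (psi : W * V -> W * 'rV[K]_r) : Prop :=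
  let UKr := [set z : W * 'rV[K]_r | U z.1] in
  let EU := total_space U E in
  [/\ [/\ regular_map UKr phi, forall z, UKr z -> EU (phi z)
        & forall z, UKr z -> psi (phi z) = z],
      [/\ regular_map EU psi, forall z, EU z -> UKr (psi z)
        & forall z, EU z -> phi (psi z) = z],
      forall z, UKr z -> (phi z).1 = z.1
    & forall u (a : K) v v', U u ->
        (phi (u, a *: v + v')).2 = a *: (phi (u, v)).2 + (phi (u, v')).2].

(* Only the values of E on X matter. *)
Definition embedded_bundle X E : Prop :=
  forall x, X x -> exists U r phi psi,
    [/\ zopen_in X U, U x & @trivialization U E r phi psi].

End Bundles.

Section Modules.
Variables (K : fieldType) (G : groupType).

Definition module_action (V : vectType K) (rho : G -> 'End(V)) : Prop :=
  rho 1%g = \1%VF /\ forall g h, rho (g * h)%g = (rho g \o rho h)%VF.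

Definition irreducible_module (V : vectType K) (rho : G -> 'End(V)) : Prop :=
  {:V}%VS != 0%VS /\
  forall U : {vspace V}, (forall g, (rho g @: U <= U)%VS) ->
    U = 0%VS \/ U = {:V}%VS.

Definition stable_set (W : vectType K) (rho : G -> 'End(W)) (X : set W) :=
  forall g x, X x -> X (rho g x).

Definition invariant_bundle (W V : vectType K) (rhoW : G -> 'End(W))
    (rhoV : G -> 'End(V)) (X : set W) (E : W -> {vspace V}) : Prop :=
  forall g x, X x -> E (rhoW g x) = (rhoV g @: E x)%VS.

End Modules.

Section Defectivity.
Variables (K : fieldType) (W V : vectType K) (k : nat).
Variables (X : set W) (X_ : 'I_k -> set W) (alpha : 'I_k -> nat).

(* A sequence of |alpha| points is an element of the vector space of functions
   from 'I_|alpha| to W, which carries the Zariski topology of W^|alpha|. *)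
Definition sequences_of_type : set {ffun 'I_(\sum_i alpha i)%N -> W} :=
  [set x | [/\ forall j, X (x j),
      forall i, #|[pred j | x j \in X_ i]| = alpha i
    & forall j i i', X_ i (x j) -> X_ i' (x j) -> i = i']].

Definition nondefective (N : 'I_k -> nat) (E : W -> {vspace V}) : Prop :=
  generally_on sequences_of_type
    [set x | \dim (\sum_j E (x j))%VS = (\sum_i alpha i * N i)%N].

End Defectivity.

(* Main.v *)
(* Let d(t) be the largest dimension of a span of fibers of E at points lying in
   the components listed in the word t; it is attained by general points. Suppose
   that d(t) < dim V and that a general point y of X_i enlarges the span F of t by
   less than N_i, so that E_y meets F. If no further point decreased the increment
   d(i :: t) - d(t), then E_y `&` F would not change when the points of t are
   exchanged one at a time, hence it would depend on y only; as G permutes the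
   general sequences, these intersections would span a nonzero submodule contained
   in F, contradicting irreducibility. So the increment can be made to drop at the
   cost of at most N_1 dimensions, and after at most N_i - 1 drops it is zero while
   the span is still proper, which is again impossible. *)
Require Import Defs.
From HB Require Import structures.
From mathcomp Require Import all_boot all_order all_algebra all_fingroup.
From mathcomp Require Import boolp classical_sets reals.
From mathcomp Require Import complex mpoly.
From mathcomp Require Import zify.

Set Implicit Arguments.
Unset Strict Implicit.
Unset Printing Implicit Defensive.

Import Order.TTheory GRing.Theory Num.Theory.
Local Open Scope ring_scope.
Local Open Scope classical_set_scope.

(** * Polynomial functions on a vector space *)

Section PolynomialFunctions.
Variables (K : fieldType) (W : vectType K).
Implicit Types (f g : W -> K) (c : K).

Definition polyfun f : Prop := exists p, f =1 peval p.

Lemma eq_polyfun f g : f =1 g -> polyfun g -> polyfun f.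
Proof. by move=> fg [p gp]; exists p => w; rewrite fg. Qed.

Lemma polyfun_cst c : polyfun (fun=> c).
Proof. by exists c%:MP => w; rewrite /peval mevalC. Qed.

Lemma polyfunD f g : polyfun f -> polyfun g -> polyfun (fun w => f w + g w).
Proof.
by move=> [p fp] [q gq]; exists (p + q) => w; rewrite /peval mevalD fp gq.
Qed.

Lemma polyfunM f g : polyfun f -> polyfun g -> polyfun (fun w => f w * g w).
Proof.
by move=> [p fp] [q gq]; exists (p * q) => w; rewrite /peval mevalM fp gq.
Qed.

Lemma polyfun_sum (J : Type) (r : seq J) (P : pred J) (F : J -> W -> K) :
  (forall j, polyfun (F j)) -> polyfun (fun w => \sum_(j <- r | P j) F j w).
Proof.
move=> FP; elim: r => [|j r IH].
  by apply: eq_polyfun (polyfun_cst 0) => w; rewrite big_nil.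
case Pj: (P j); last first.
  by apply: eq_polyfun IH => w; rewrite big_cons Pj.
by apply: eq_polyfun (polyfunD (FP j) IH) => w; rewrite big_cons Pj.
Qed.

Lemma polyfun_prod (J : Type) (r : seq J) (P : pred J) (F : J -> W -> K) :
  (forall j, polyfun (F j)) -> polyfun (fun w => \prod_(j <- r | P j) F j w).
Proof.
move=> FP; elim: r => [|j r IH].
  by apply: eq_polyfun (polyfun_cst 1) => w; rewrite big_nil.
case Pj: (P j); last first.
  by apply: eq_polyfun IH => w; rewrite big_cons Pj.
by apply: eq_polyfun (polyfunM (FP j) IH) => w; rewrite big_cons Pj.
Qed.

Lemma polyfunX f n : polyfun f -> polyfun (fun w => f w ^+ n).
Proof.
move=> fP; elim: n => [|n IH]; first exact: polyfun_cst.
by apply: eq_polyfun (polyfunM fP IH) => w; rewrite exprS.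
Qed.

Lemma polyfun_coord i : polyfun (fun w : W => coord (vbasis {:W}) i w).
Proof. by exists 'X_i => w; rewrite /peval mevalXU. Qed.

Lemma polyfun_linear f : (forall c u v, f (c *: u + v) = c * f u + f v) ->
  polyfun f.
Proof.
move=> fL.
have f0 : f 0 = 0.
  by apply: (addrI (f 0)); rewrite addr0 -{1}[f 0]mul1r -fL scale1r addr0.
have fD u v : f (u + v) = f u + f v by rewrite -{1}[u]scale1r fL mul1r.
have fZ c u : f (c *: u) = c * f u by rewrite -[_ *: _]addr0 fL f0 addr0.
pose F i w := coord (vbasis {:W}) i w * f (vbasis {:W})`_i.
apply: (@eq_polyfun _ (fun w => \sum_i F i w)) => [w|].
  rewrite {1}(coord_vbasis (memvf w)) (big_morph f fD f0).
  by apply: eq_bigr => i _; rewrite fZ.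
by apply: polyfun_sum => i; apply: polyfunM (polyfun_coord i) (polyfun_cst _).
Qed.

Lemma polyfun_det n (M : W -> 'M[K]_n) :
  (forall i j, polyfun (fun w => M w i j)) -> polyfun (fun w => \det (M w)).
Proof.
move=> MP; apply: polyfun_sum => s.
by apply: polyfunM (polyfun_cst _) _; apply: polyfun_prod => i.
Qed.

End PolynomialFunctions.

(** * Polynomial maps between vector spaces *)

Section PolynomialMaps.
Variable K : fieldType.

Definition polymap (W W' : vectType K) (g : W -> W') : Prop :=
  forall i, polyfun (fun w => coord (vbasis {:W'}) i (g w)).

Lemma polyfun_comp (W W' : vectType K) (f : W' -> K) (g : W -> W') :
  polyfun f -> polymap g -> polyfun (fun w => f (g w)).
Proof.
move=> [p fp] gP; apply: (eq_polyfun (fun w => fp (g w))); rewrite /peval.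
apply: (eq_polyfun (fun w => mevalE _ _)).
apply: polyfun_sum => m; apply: polyfunM (polyfun_cst _ _) _.
by apply: polyfun_prod => i; apply: polyfunX.
Qed.

Lemma polymap_affine (W W' : vectType K) (L : W -> W') (c : W') :
  linear L -> polymap (fun w => L w + c).
Proof.
move=> LL i; apply: (@eq_polyfun _ _ _
    (fun w => coord (vbasis {:W'}) i (L w) + coord (vbasis {:W'}) i c)) => [w|].
  by rewrite linearD.
apply: polyfunD (polyfun_cst _ _); apply: polyfun_linear => a u v.
by rewrite LL linearP.
Qed.

Lemma polymap_linear (W W' : vectType K) (L : W -> W') :
  linear L -> polymap L.
Proof.
move=> LL i; apply: eq_polyfun (polymap_affine 0 LL i) => w.
by rewrite addr0.
Qed.

Lemma polymap_cst (W W' : vectType K) (c : W') : polymap (fun _ : W => c).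
Proof. by move=> i; apply: polyfun_cst. Qed.

Lemma polymapZ (W W' : vectType K) (f : W -> K) (g : W -> W') :
  polyfun f -> polymap g -> polymap (fun w => f w *: g w).
Proof.
move=> fP gP i; apply: eq_polyfun (polyfunM fP (gP i)) => w.
by rewrite linearZ.
Qed.

Lemma polymap_sum (W W' : vectType K) (J : Type) (r : seq J) (P : pred J)
    (F : J -> W -> W') :
  (forall j, polymap (F j)) -> polymap (fun w => \sum_(j <- r | P j) F j w).
Proof.
move=> FP i; apply: eq_polyfun (polyfun_sum r P (fun j => FP j i)) => w.
by rewrite linear_sum.
Qed.

Lemma polymap_comp (W W' W'' : vectType K) (g : W' -> W'') (h : W -> W') :
  polymap g -> polymap h -> polymap (fun w => g (h w)).
Proof. by move=> gP hP i; exact: polyfun_comp (gP i) hP. Qed.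

End PolynomialMaps.

(** * The Zariski topology through principal open sets *)

Section ZariskiTopology.
Variable K : fieldType.

(** The nonvanishing loci of polynomial functions form a basis of the topology. Openness thus
    becomes a pointwise condition, which passes easily to unions and to preimages under polynomial
    maps. *)
Lemma zopenP (W : vectType K) (O : set W) :
  zopen O <-> forall w, O w ->
    exists2 f, polyfun f & f w != 0 /\ forall u, f u != 0 -> O u.
Proof.
split=> [[I OI] w Ow|H].
  have : ~ (~` O) w by [].
  rewrite {1}OI /= => /existsNP [p /not_implyP[Ip /eqP pw]].
  exists (peval p); first by exists p.
  split=> // u /eqP pu; apply: contrapT => nOu; apply: pu.
  have : (~` O) u by [].
  by rewrite OI; apply.
exists [set p | forall u, ~ O u -> peval p u = 0].
apply/seteqP; split=> [w nOw p|w Hw] /=; first exact.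
move=> /H [f [p fp] [fw fO]].
move/eqP: fw; apply; rewrite fp; apply: Hw => u nOu.
by apply: contrapT => /eqP pu; apply: nOu; apply: fO; rewrite fp.
Qed.

Lemma zopenT (W : vectType K) : zopen [set: W].
Proof.
by apply/zopenP => w _; exists (fun=> 1); [exact: polyfun_cst | rewrite oner_neq0].
Qed.

Lemma zopenI (W : vectType K) (A B : set W) :
  zopen A -> zopen B -> zopen (A `&` B).
Proof.
move=> /zopenP HA /zopenP HB; apply/zopenP => w [/HA[f fP [fw fA]] /HB[g gP [gw gB]]].
exists (fun u => f u * g u); first exact: polyfunM.
split=> [|u]; first by rewrite mulf_neq0.
by rewrite mulf_eq0 negb_or => /andP[fu gu]; split; [apply: fA | apply: gB].
Qed.

Lemma zopen_bigcup (W : vectType K) (J : Type) (D : set J) (F : J -> set W) :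
  (forall j, D j -> zopen (F j)) -> zopen (\bigcup_(j in D) F j).
Proof.
move=> FO; apply/zopenP => w [j Dj Fw].
have /zopenP/(_ w Fw)[f fP [fw fF]] := FO j Dj.
by exists f => //; split=> // u /fF Fu; exists j.
Qed.

Lemma zopen_forall (W : vectType K) (J : eqType) (s : seq J) (F : J -> set W) :
  (forall j, zopen (F j)) -> zopen [set w | forall j, j \in s -> F j w].
Proof.
move=> FO; elim: s => [|j s IH].
  rewrite (_ : mkset _ = setT); first exact: zopenT.
  by apply/seteqP; split.
rewrite (_ : mkset _ = F j `&` [set w | forall j, j \in s -> F j w]).
  exact: zopenI.
apply/seteqP; split=> [w H|w [Fw H] i] /=.
  split=> [|i si]; first by apply: H; rewrite mem_head.
  by apply: H; rewrite in_cons si orbT.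
by rewrite in_cons => /orP[/eqP->|/H].
Qed.

Lemma zopen_preimage (W W' : vectType K) (g : W -> W') (O : set W') :
  polymap g -> zopen O -> zopen (g @^-1` O).
Proof.
move=> gP /zopenP HO; apply/zopenP => w /HO[f fP [fw fO]].
by exists (fun u => f (g u)); [exact: polyfun_comp | split=> // u /fO].
Qed.

End ZariskiTopology.

(** * Lower semicontinuity of the dimension of a family of subspaces *)

Section Semicontinuity.
Variable K : fieldType.

(* The half of local triviality that lower semicontinuity of dim needs. *)
Definition locally_spanned (W V : vectType K) (X : set W) (H : W -> {vspace V})
    (x : W) : Prop :=
  exists O (s : seq (W -> V)),
    [/\ zopen O, O x, forall j, polymap (nth (fun=> 0) s j),
        forall u, X u -> O u -> (<<[seq f u | f <- s]>> <= H u)%VS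
      & (H x <= <<[seq f x | f <- s]>>)%VS].

(** Write a basis of the span at [x] as combinations of the vectors [f x]. The same constant
    coefficients applied to the vectors [f u] give elements [v u l] of the span at [u]. These stay
    independent as long as the determinant of [M u], which is 1 at [x], does not vanish. *)
Lemma span_lower_semicontinuous (W V : vectType K) (s : seq (W -> V)) (x : W) :
  (forall j, polymap (nth (fun=> 0) s j)) ->
  exists O, [/\ zopen O, O x & forall u, O u ->
    (\dim <<[seq f x | f <- s]>> <= \dim <<[seq f u | f <- s]>>)%N].
Proof.
move=> sP; set U := <<_>>%VS.
pose S u := map_tuple (fun f : W -> V => f u) (in_tuple s).
pose B := vbasis U; pose r : nat := \dim U.
pose v u (l : 'I_r) := \sum_(i < size s) coord (S x) i B`_l *: (S u)`_i.
have Bv (l : 'I_r) : B`_l = v x l.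
  by apply: coord_span; apply: vbasis_mem; rewrite mem_nth ?size_tuple.
have vP l : polymap (fun u => v u l).
  apply: polymap_sum => i; apply: polymapZ; first exact: polyfun_cst.
  move=> j; apply: eq_polyfun (sP i j) => w; congr (coord _ _ _).
  by rewrite (nth_map (fun=> 0)).
pose M u := \matrix_(l, l') coord B l' (v u l).
have MP : polyfun (fun u => \det (M u)).
  apply: polyfun_det => l l'.
  apply: (@eq_polyfun _ _ _ (fun u => coord B l' (v u l))) => [u|].
    by rewrite mxE.
  apply: polyfun_comp (vP l); apply: polyfun_linear => c u w.
  by rewrite linearP.
have BF : free B by apply: basis_free (vbasisP _).
have Mx : M x = 1%:M.
  by apply/matrixP => l l'; rewrite !mxE -Bv coord_free // eq_sym.
exists [set u | \det (M u) != 0]; split.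
- by apply/zopenP => w Ow; exists (fun u => \det (M u)).
- by rewrite /= Mx det1 oner_neq0.
move=> u /= Mu.
pose T := [tuple v u l | l < r].
have TU : (<<T>> <= <<[seq f u | f <- s]>>)%VS.
  apply/span_subvP => w /mapP[l _ ->]; apply: memv_suml => i _.
  apply: memvZ; apply: memv_span; apply: mem_nth.
  by rewrite size_map.
apply: leq_trans (dimvS TU).
suff /eqP-> : free T by rewrite size_tuple.
apply/freeP => k Hk l.
suff /rowP/(_ l) : (\row_l k l) = 0 :> 'rV_r by rewrite !mxE.
have Munit : M u \in unitmx by rewrite unitmxE unitfE.
rewrite -[LHS](mulmxK Munit) [_ *m M u](_ : _ = 0) ?mul0mx //.
apply/rowP => l'; rewrite !mxE.
transitivity (coord B l' (\sum_(i < r) k i *: T`_i)); last by rewrite Hk linear0.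
rewrite linear_sum; apply: eq_bigr => i _.
by rewrite linearZ !mxE -tnth_nth tnth_mktuple.
Qed.

Lemma dim_lower_semicontinuous (W V : vectType K) (X : set W)
    (H : W -> {vspace V}) (x : W) :
  locally_spanned X H x ->
  exists O, [/\ zopen O, O x &
    forall u, X u -> O u -> (\dim (H x) <= \dim (H u))%N].
Proof.
move=> [O [s [OO Ox sP sH Hs]]].
have [O' [OO' O'x sO']] := span_lower_semicontinuous x sP.
exists (O `&` O'); split; [exact: zopenI | by split |].
move=> u Xu [Ou O'u].
exact: leq_trans (dimvS Hs) (leq_trans (sO' u O'u) (dimvS (sH u Xu Ou))).
Qed.

Lemma locally_spanned_cst (W V : vectType K) (X : set W) (F : {vspace V}) x :
  locally_spanned X (fun=> F) x.
Proof.
exists setT, [seq (fun=> v) | v <- vbasis F]; split=> //.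
- exact: zopenT.
- move=> j; case: (ltnP j (size (vbasis F))) => hj.
    by rewrite (nth_map 0) //; apply: polymap_cst.
  by rewrite nth_default ?size_map //; apply: polymap_cst.
- move=> u _ _; rewrite -map_comp (eq_map (g := id)) // map_id.
  by rewrite (span_basis (vbasisP F)).
- rewrite -map_comp (eq_map (g := id)) // map_id.
  by rewrite (span_basis (vbasisP F)).
Qed.

Lemma locally_spannedD (W V : vectType K) (X : set W)
    (H1 H2 : W -> {vspace V}) x :
  locally_spanned X H1 x -> locally_spanned X H2 x ->
  locally_spanned X (fun u => H1 u + H2 u)%VS x.
Proof.
move=> [O1 [s1 [OO1 O1x s1P s1H Hs1]]] [O2 [s2 [OO2 O2x s2P s2H Hs2]]].
exists (O1 `&` O2), (s1 ++ s2); split; first exact: zopenI.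
- by [].
- by move=> j; rewrite nth_cat; case: ifP.
- move=> u Xu [O1u O2u]; rewrite map_cat span_cat.
  by apply: addvS; [apply: s1H | apply: s2H].
- by rewrite map_cat span_cat; apply: addvS.
Qed.

Lemma locally_spanned_sum (W V : vectType K) (X : set W) (J : Type)
    (r : seq J) (H : J -> W -> {vspace V}) x :
  (forall j, locally_spanned X (H j) x) ->
  locally_spanned X (fun u => \sum_(j <- r) H j u)%VS x.
Proof.
move=> HP; elim: r => [|j r IH].
  have [O [s Os]] := locally_spanned_cst X (0%VS : {vspace V}) x.
  exists O, s; case: Os => OO Ox sP sH Hs.
  by split=> //; [move=> u Xu Ou|]; rewrite big_nil //; apply: sH.
have [O [s Os]] := locally_spannedD (HP j) IH.
exists O, s; case: Os => OO Ox sP sH Hs.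
by split=> //; [move=> u Xu Ou|]; rewrite big_cons //; apply: sH.
Qed.

Lemma locally_spanned_pullback (W W' V : vectType K) (X : set W) (X' : set W')
    (g : W' -> W) (H : W -> {vspace V}) x :
  polymap g -> (forall u, X' u -> X (g u)) ->
  locally_spanned X H (g x) -> locally_spanned X' (fun u => H (g u)) x.
Proof.
move=> gP gX [O [s [OO Ox sP sH Hs]]].
exists (g @^-1` O), [seq (fun u => f (g u)) | f <- s]; split.
- exact: zopen_preimage.
- exact: Ox.
- move=> j; case: (ltnP j (size s)) => hj.
    by rewrite (nth_map (fun=> 0)) //; apply: polymap_comp (sP j) gP.
  by rewrite nth_default ?size_map //; apply: polymap_cst.
- by move=> u X'u Ou; rewrite -map_comp; apply: sH => //; apply: gX.
- by rewrite -map_comp.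
Qed.

(** A local trivialization carries the standard basis of row vectors to regular sections that span
    the fibers. Clearing denominators makes them polynomial and only rescales them by scalars that
    are nonzero near [x]. *)
Lemma locally_spanned_bundle (W V : vectType K) (X : set W)
    (E : W -> {vspace V}) x :
  embedded_bundle X E -> X x -> locally_spanned X E x.
Proof.
move=> EX Xx; have [U [r [phi [psi [[O OO UO] Ux]]]]] := EX x Xx.
move=> [[phiR phiE phiK] [_ psiU psiK] phi1 phiL].
pose b := vbasis {: (W * V)%type}.
have /choice[D DP] : forall l : 'I_r, exists D : (set W * (W -> V))%type,
  [/\ zopen D.1, D.1 x, polymap D.2 & forall u, U u -> D.1 u ->
    exists2 a, a != 0 & D.2 u = a *: (phi (u, delta_mx 0 l)).2].
  move=> l; have Uxl : U (x, delta_mx 0 l : 'rV[K]_r).1 by [].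
  have /choice[T TP] : forall i, exists T : (set (W * 'rV[K]_r) *
      ({mpoly K[\dim {: (W * 'rV[K]_r)%type}]} *
       {mpoly K[\dim {: (W * 'rV[K]_r)%type}]}))%type,
      [/\ zopen T.1, T.1 (x, delta_mx 0 l) & forall u, U u.1 -> T.1 u ->
        peval T.2.2 u != 0 /\ coord b i (phi u) = peval T.2.1 u / peval T.2.2 u].
    move=> i; have [O' [p [q [OO' O'x H]]]] := phiR i (x, delta_mx 0 l) Uxl.
    by exists (O', (p, q)); split.
  pose e u : (W * 'rV[K]_r)%type := (u, delta_mx 0 l).
  have eP : polymap e.
    have eL : linear (fun u : W => (u, 0 : 'rV[K]_r)).
      by move=> a u v; congr pair; rewrite /= scaler0 addr0.
    move=> i; apply: eq_polyfun (polymap_affine (0, delta_mx 0 l) eL i) => u.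
    by congr (coord _ _ _); congr pair; rewrite ?addr0 ?add0r.
  pose p i u := peval (T i).2.1 (e u); pose q i u := peval (T i).2.2 (e u).
  have pP i : polyfun (p i) by apply: polyfun_comp eP; eexists.
  have qP i : polyfun (q i) by apply: polyfun_comp eP; eexists.
  (* The polynomial map is the section times the product of all denominators [q i], with the
     division in each coordinate already cancelled. *)
  exists (e @^-1` [set z | forall i,
            i \in enum 'I_(\dim {: (W * V)%type}) -> (T i).1 z],
          fun u => \sum_i (p i u * \prod_(i' | i' != i) q i' u) *: (b`_i).2).
  split=> /=.
  - apply: zopen_preimage => //; apply: zopen_forall => i.
    by case: (TP i).
  - by move=> i _; case: (TP i).
  - apply: polymap_sum => i; apply: polymapZ; last exact: polymap_cst.
    by apply: polyfunM => //; apply: polyfun_prod.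
  move=> u Uu Tu; have {}TP i := let: And3 _ _ H := TP i in
    H (e u) Uu (Tu i (mem_enum _ i)).
  exists (\prod_i q i u).
    by apply/prodf_neq0 => i _; have [] := TP i.
  rewrite [in RHS](coord_vbasis (memvf (phi _))).
  rewrite (big_morph snd (id1 := 0) (op1 := +%R)) // scaler_sumr.
  apply: eq_bigr => i _.
  have [qi ->] := TP i.
  rewrite scalerA -/(p i u) -/(q i u); congr (_ *: _).
  by rewrite [in RHS](bigD1 i) //= [RHS]mulrC mulrA mulfVK.
have UX u : U u -> X u by rewrite UO => -[].
pose Os := [set u | forall l, l \in enum 'I_r -> (D l).1 u].
exists (O `&` Os), [seq (D l).2 | l <- enum 'I_r]; split.
- by apply: zopenI => //; apply: zopen_forall => l; case: (DP l).
- by split=> [|l _]; [move: Ux; rewrite UO => -[] | case: (DP l)].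
- move=> j; case: (ltnP j (size (enum 'I_r))) => hj; last first.
    by rewrite nth_default; [exact: polymap_cst | rewrite size_map].
  have [l0 _] : exists l0 : 'I_r, True.
    by rewrite size_enum_ord in hj; exists (Ordinal hj).
  by rewrite (nth_map l0) //; case: (DP (nth l0 (enum 'I_r) j)).
- move=> u Xu [Ou Osu]; have Uu : U u by rewrite UO.
  apply/span_subvP => w /mapP[f /mapP[l _ ->] ->].
  have [_ _ _ /(_ u Uu (Osu l (mem_enum _ l)))[a _ ->]] := DP l.
  apply: memvZ.
  have [_] := phiE (u, delta_mx 0 l) Uu.
  by rewrite phi1.
(* The inverse [psi] writes [v] as the image of a row vector [c], hence as a combination of the
   sections at [x]. *)
apply/subvP => v Ev.
have Ev' : total_space U E (x, v) by [].
have := psiK _ Ev'; have := psiU _ Ev'; case: (psi (x, v)) => x' c /= Ux' phix'.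
have := phi1 (x', c) Ux'; rewrite phix' /= => xx'; rewrite -{}xx' {x'} in phix' Ux'.
pose h c := (phi (x, c)).2.
have hL : linear h by move=> a c1 c2; apply: phiL.
pose h' : {linear 'rV[K]_r -> V} := HB.pack h (GRing.isLinear.Build _ _ _ _ h hL).
have -> : v = h' c by rewrite /= /h phix'.
rewrite [c]row_sum_delta linear_sum; apply: memv_suml => l _.
rewrite linearZ; apply: memvZ.
have [_ Dx _ /(_ x Ux Dx)[a a0 Da]] := DP l.
have -> : h' (delta_mx 0 l) = a^-1 *: (D l).2 x.
  by rewrite Da scalerA mulVf // scale1r.
apply: memvZ; apply: memv_span; apply/mapP; exists (D l).2 => //.
by apply/mapP; exists l => //; rewrite mem_enum.
Qed.

End Semicontinuity.

(** * Sums of families of subspaces *)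

Lemma addvCA (K : fieldType) (V : vectType K) :
  left_commutative (@addv K V).
Proof. by move=> A B C; rewrite !addvA [(A + B)%VS]addvC. Qed.

Lemma subv_sum_seq (K : fieldType) (V : vectType K) (J : eqType) (s : seq J)
    (F : J -> {vspace V}) (U : {vspace V}) :
  (forall j, j \in s -> (F j <= U)%VS) -> (\sum_(j <- s) F j <= U)%VS.
Proof.
move=> FU; rewrite big_seq; elim/big_ind: _ => //; first exact: sub0v.
by move=> A B AU BU; rewrite subv_add AU.
Qed.

(** If every finite family failed, adjoining one more subspace each time would raise the dimension
    without bound. Finiteness matters because only finitely many generic conditions can be imposed
    at once. *)
Lemma finitely_many_subspaces_suffice (K : fieldType) (V : vectType K)
    (Q : {vspace V} -> Prop) :
  exists2 Hs : seq {vspace V}, (forall H, H \in Hs -> Q H)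
    & forall H, Q H -> (H <= \sum_(H' <- Hs) H')%VS.
Proof.
apply: contrapT => nQ.
suff grow n : exists2 Hs : seq {vspace V}, (forall H, H \in Hs -> Q H)
    & (n <= \dim (\sum_(H' <- Hs) H')%VS)%N.
  have [Hs _] := grow (\dim {:V}).+1.
  by rewrite ltnNge dimvS ?subvf.
elim: n => [|n [Hs QHs nHs]]; first by exists [::].
have [H QH HHs] : exists2 H, Q H & ~ (H <= \sum_(H' <- Hs) H')%VS.
  apply: contrapT => nH; apply: nQ; exists Hs => // H QH.
  by apply: contrapT => HHs; apply: nH; exists H.
exists (H :: Hs) => [H'|].
  by rewrite in_cons => /orP[/eqP-> //|/QHs].
apply: leq_ltn_trans nHs _; rewrite big_cons ltn_neqAle dimvS ?addvSr // andbT.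
rewrite (dimv_leqif_eq (addvSr _ _)); apply/negP => /eqP Heq; apply: HHs.
by rewrite Heq addvSl.
Qed.

(** * Spans of fibers at general points, for an axiomatic notion of generality *)

Section GeneralSpans.
Variables (K : fieldType) (W : Type) (V : vectType K) (I : eqType).
Variables (X_ : I -> set W) (E : W -> {vspace V}) (N : I -> nat).
Hypothesis dimE : forall l u, X_ l u -> \dim (E u) = N l.

(* [gen l P] stands for "P holds for a general point of X_ l". *)
Variable gen : I -> set W -> Prop.
Hypothesis gen_self : forall l, gen l (X_ l).
Hypothesis gen_ex : forall l P, gen l P -> exists u, P u.
Hypothesis genS : forall l (P Q : set W),
  (forall u, P u -> Q u) -> gen l P -> gen l Q.
Hypothesis genI : forall l P Q, gen l P -> gen l Q -> gen l (P `&` Q).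
Hypothesis gen_dim : forall l (F : {vspace V}) v, X_ l v ->
  gen l [set u | (\dim (F + E v) <= \dim (F + E u))%N].

Implicit Types (t : seq I) (x : seq W) (A B : set (seq W)).

Lemma gen_and3 l (P Q T : set W) : gen l P -> gen l Q -> gen l T ->
  gen l [set u | [/\ P u, Q u & T u]].
Proof.
move=> gP gQ gT; apply: genS (genI gP (genI gQ gT)) => u.
by move=> [Pu [Qu Tu]]; split.
Qed.

Lemma gen_forall (J : eqType) (s : seq J) l (P : J -> set W) :
  (forall j, j \in s -> gen l (P j)) ->
  gen l [set u | forall j, j \in s -> P j u].
Proof.
elim: s => [|j s IH] gP; first exact: genS (gen_self l).
have gs : forall j', j' \in s -> gen l (P j').
  by move=> j' sj'; apply: gP; rewrite in_cons sj' orbT.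
apply: genS (genI (gP j (mem_head _ _)) (IH gs)) => u [Pj Ps] j'.
by rewrite in_cons => /orP[/eqP->|/Ps].
Qed.

(** The word [t] prescribes one component per position, so that points can be exchanged one at a
    time by splitting [t]. A point may lie in further components as well. *)
Fixpoint points_of_type t x : Prop :=
  match t, x with
  | [::], [::] => True
  | l :: t', u :: x' => X_ l u /\ points_of_type t' x'
  | _, _ => False
  end.

Definition spanE x : {vspace V} := (\sum_(u <- x) E u)%VS.

Lemma points_of_type_cat t1 t2 x1 x2 :
  points_of_type t1 x1 -> points_of_type t2 x2 ->
  points_of_type (t1 ++ t2) (x1 ++ x2).
Proof.
elim: t1 x1 => [|l t1 IH] [|u x1] //= [Xu H1] H2.
by split=> //; apply: IH.
Qed.

Lemma points_of_typeP t x (l0 : I) (u0 : W) :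
  points_of_type t x <-> size x = size t /\
    forall j, (j < size t)%N -> X_ (nth l0 t j) (nth u0 x j).
Proof.
elim: t x => [|l t IH] [|u x] /=.
- by split.
- by split=> // -[].
- by split=> // -[].
split=> [[Xu /IH[-> H]]|[[sx] H]]; first by split=> // -[|j] //; exact: H.
by split; [exact: (H 0%N) | apply/IH; split=> // j; exact: (H j.+1)].
Qed.

Lemma points_of_type_size t x : points_of_type t x -> size x = size t.
Proof. by elim: t x => [|l t IH] [|u x] //= [_ /IH->]. Qed.

Lemma points_of_type_map (J : Type) (s : seq J) (t : J -> I) (f : J -> W) :
  (forall j, X_ (t j) (f j)) -> points_of_type (map t s) (map f s).
Proof. by move=> tf; elim: s => //= j s IH; split. Qed.

Lemma points_of_type_ex t : exists x, points_of_type t x.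
Proof.
elim: t => [|l t [x Hx]]; first by exists [::].
by have [u Xu] := gen_ex (gen_self l); exists (u :: x).
Qed.

Lemma spanE_cons u x : spanE (u :: x) = (E u + spanE x)%VS.
Proof. exact: big_cons. Qed.

Lemma spanE_replace x1 u x2 : spanE (x1 ++ u :: x2) = (spanE (x1 ++ x2) + E u)%VS.
Proof. by rewrite /spanE !big_cat big_cons /= [(E u + _)%VS]addvC addvA. Qed.

(* Changing one coordinate of a point of A generically stays inside A; unlike
   openness in the product, this needs only the topologies of the factors. *)
Definition separately_open t A : Prop :=
  forall t1 l t2 x1 v x2, t = t1 ++ l :: t2 ->
    points_of_type t1 x1 -> X_ l v -> points_of_type t2 x2 ->
    A (x1 ++ v :: x2) -> gen l [set u | A (x1 ++ u :: x2)].

Lemma separately_openI t A B :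
  separately_open t A -> separately_open t B -> separately_open t (A `&` B).
Proof.
move=> oA oB t1 l t2 x1 v x2 tE H1 Xv H2 [Av Bv].
exact: genI (oA _ _ _ _ _ _ tE H1 Xv H2 Av) (oB _ _ _ _ _ _ tE H1 Xv H2 Bv).
Qed.

(** The two sequences are merged from left to right: a general point of the next component can
    replace the current point of both sequences without leaving [A] or [B]. *)
Lemma separately_open_meet t A B a b :
  separately_open t A -> separately_open t B ->
  points_of_type t a -> A a -> points_of_type t b -> B b ->
  exists c, [/\ points_of_type t c, A c & B c].
Proof.
move=> oA oB Ha Aa Hb Bb.
(* The invariant is a common prefix [w] that [a'] completes to an element of [A] and [b'] to an
   element of [B]. *)
suff main t2 : forall t1 w a' b', t = t1 ++ t2 -> points_of_type t1 w ->
    points_of_type t2 a' -> A (w ++ a') -> points_of_type t2 b' -> B (w ++ b') ->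
    exists c, [/\ points_of_type t c, A c & B c].
  exact: (main t [::] [::] a b).
elim: t2 => [|l t2 IH] t1 w [|v a'] [|v' b'] //= tE Hw.
  by move=> _ Aw _ Bw; exists w; rewrite tE; split; rewrite ?cats0 // in Aw Bw *.
move=> [Xv Ha'] Av [Xv' Hb'] Bv'.
have gA := oA _ _ _ _ _ _ tE Hw Xv Ha' Av.
have gB := oB _ _ _ _ _ _ tE Hw Xv' Hb' Bv'.
have [u [Xu Au Bu]] := gen_ex (gen_and3 (gen_self l) gA gB).
apply: (IH (rcons t1 l) (rcons w u) a' b'); rewrite ?cat_rcons //.
by rewrite -!cats1; apply: points_of_type_cat.
Qed.

Lemma separately_open_meet_all t B (s : seq I) (A : I -> set (seq W)) :
  separately_open t B -> (exists2 b, points_of_type t b & B b) ->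
  (forall l, l \in s -> separately_open t (A l)) ->
  (forall l, l \in s -> exists2 a, points_of_type t a & A l a) ->
  exists c, [/\ points_of_type t c, B c & forall l, l \in s -> A l c].
Proof.
elim: s B => [|l s IH] B oB [b Hb Bb] oA neA; first by exists b.
have ls : l \in l :: s by rewrite mem_head.
have ss l' : l' \in s -> l' \in l :: s by rewrite in_cons => ->; rewrite orbT.
have [a Ha Aa] := neA l ls.
have [c [Hc Ac Bc]] := separately_open_meet (oA l ls) oB Ha Aa Hb Bb.
have [||l' /ss|l' /ss|c' [Hc' [Bc' Ac'] As]] := IH (B `&` A l).
- exact: separately_openI (oA l ls).
- by exists c.
- exact: oA.
- exact: neA.
by exists c'; split=> // l'; rewrite in_cons => /orP[/eqP->|/As].
Qed.

Lemma separately_open_dim t (F : {vspace V}) n :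
  separately_open t [set x | (n <= \dim (F + spanE x))%N].
Proof.
move=> t1 l t2 x1 v x2 _ _ Xv _ /= nF.
apply: genS (gen_dim (F + spanE (x1 ++ x2)) Xv) => u /=.
by rewrite !spanE_replace !addvA in nF *; apply: leq_trans.
Qed.

(** By semicontinuity the dimension at general points is the largest one. Defining it as a maximum,
    over a range made finite by [\dim {:V}], avoids choosing general points. *)
Definition general_dim t : nat :=
  \max_(n < (\dim {:V}).+1 |
    `[< exists2 x, points_of_type t x & \dim (spanE x) = n >]) n.
Local Notation d := general_dim.

Lemma general_dim_max t x : points_of_type t x -> (\dim (spanE x) <= d t)%N.
Proof.
move=> Hx; have dx : (\dim (spanE x) < (\dim {:V}).+1)%N by rewrite ltnS dimvS ?subvf.
by apply: (leq_bigmax_cond (Ordinal dx)); apply/asboolP; exists x.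
Qed.

Lemma general_dim_attained t :
  exists2 x, points_of_type t x & \dim (spanE x) = d t.
Proof.
have [x Hx] := points_of_type_ex t.
have dx : (\dim (spanE x) < (\dim {:V}).+1)%N by rewrite ltnS dimvS ?subvf.
have [|n /asboolP Pn dn] := @eq_bigmax_cond _
  [pred n : 'I_(\dim {:V}).+1 |
    `[< exists2 x, points_of_type t x & \dim (spanE x) = n >]] (@nat_of_ord _).
  by apply/card_gt0P; exists (Ordinal dx); apply/asboolP; exists x.
by rewrite /d dn.
Qed.

Lemma general_dim_cons_ge l t : (d t <= d (l :: t))%N.
Proof.
have [x Hx <-] := general_dim_attained t.
have [u Xu] := gen_ex (gen_self l).
apply: leq_trans (general_dim_max (_ : points_of_type (l :: t) (u :: x))) => //.
by rewrite spanE_cons dimvS ?addvSr.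
Qed.

Lemma general_dim_cons_le l t : (d (l :: t) <= d t + N l)%N.
Proof.
have [[|u x] // [Xu Hx] <-] := general_dim_attained (l :: t).
rewrite spanE_cons (leq_trans (dimv_add_leqif _ _)) // (dimE Xu) addnC.
by rewrite leq_add2r general_dim_max.
Qed.

(** The span does not depend on the order of the points, which can therefore be permuted along with
    the word. This later allows the word to be sorted. *)
Lemma general_dim_perm t t' : perm_eq t t' -> d t = d t'.
Proof.
suff le t1 t2 : perm_eq t1 t2 -> (d t2 <= d t1)%N.
  by move=> tt'; apply/eqP; rewrite eqn_leq !le // perm_sym.
move=> tt'; have [x Hx <-] := general_dim_attained t2.
case: t2 => [|l0 t2] in tt' Hx *.
  by case: x Hx => //; rewrite /spanE big_nil dimv0.
case: x Hx => // u0 x Hx.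
have [/= sx /= Xx] := (points_of_typeP _ _ l0 u0).1 Hx.
have [Is pIs t1E] := perm_iotaP l0 tt'.
have Hmap : points_of_type t1 (map (nth u0 (u0 :: x)) Is).
  apply/(points_of_typeP _ _ l0 u0); rewrite t1E !size_map; split=> // j hj.
  rewrite !(nth_map 0%N) //; apply: Xx.
  have : nth 0%N Is j \in iota 0 (size (l0 :: t2)).
    by rewrite -(perm_mem pIs) mem_nth.
  by rewrite mem_iota.
apply: leq_trans (general_dim_max Hmap).
have xE : map (nth u0 (u0 :: x)) (iota 0 (size (l0 :: t2))) = u0 :: x.
  exact: etrans (congr1 (mkseq (nth u0 (u0 :: x))) (esym sx)) (mkseq_nth _ _).
rewrite -[in X in (X <= _)%N]xE.
by rewrite /spanE [in X in (_ <= X)%N]big_map (perm_big _ pIs) big_map.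
Qed.

(** * The group action and the use of irreducibility *)

Section IrreducibleModule.
Variables (G : Type) (aW : G -> W -> W) (aV : G -> 'End(V)).
Hypothesis aV_inj : forall g, lker (aV g) = 0%VS.
Hypothesis aW_stable : forall g l u, X_ l u -> X_ l (aW g u).
Hypothesis aE : forall g l u, X_ l u -> E (aW g u) = (aV g @: E u)%VS.
Hypothesis V_irreducible : forall U : {vspace V},
  (forall g, (aV g @: U <= U)%VS) -> U = 0%VS \/ U = {:V}%VS.

Lemma dim_limg g (U : {vspace V}) : \dim (aV g @: U)%VS = \dim U.
Proof. by apply: limg_dim_eq; rewrite aV_inj capv0. Qed.

Lemma points_of_type_act g t x :
  points_of_type t x -> points_of_type t (map (aW g) x).
Proof.
elim: t x => [|l t IH] [|u x] //= [Xu Hx].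
by split; [apply: aW_stable | apply: IH].
Qed.

Lemma spanE_act g t x : points_of_type t x ->
  spanE (map (aW g) x) = (aV g @: spanE x)%VS.
Proof.
elim: t x => [|l t IH] [|u x] //=.
  by rewrite /spanE !big_nil limg0.
by move=> [Xu Hx]; rewrite !spanE_cons limgD (aE g Xu) IH.
Qed.

(* If no additional point decreased the increment, E y `&` spanE x would not
   depend on the general sequence x, so these intersections would together span
   a nonzero invariant subspace contained in a single spanE x. *)
Lemma increment_decreases t i :
  (d t < \dim {:V})%N -> (d (i :: t) < d t + N i)%N ->
  exists2 l, l \in t & (d (i :: l :: t) + d t < d (i :: t) + d (l :: t))%N.
Proof.
move=> dV dN; apply: contrapT => stall.
have {}stall l : l \in t -> (d (i :: t) + d (l :: t) <= d (i :: l :: t) + d t)%N.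
  by move=> lt; rewrite leqNgt; apply/negP => H; apply: stall; exists l.
(* [wide] says that [z] extends [y :: x] to a span of the largest possible dimension. In [good] the
   extending point is existential and may depend on [l], so that the condition survives general
   replacements and the group action. *)
pose wide y x l z := (d (i :: l :: t) <= \dim (E z + spanE (y :: x)))%N.
pose good x y := (d t <= \dim (spanE x))%N /\
  forall l, l \in t -> exists2 z, X_ l z & wide y x l z.
(* By the dimension formula for sums and intersections, [stall] implies that enlarging [spanE x] by
   [E z] does not enlarge its intersection with [E y]. *)
have cap x y l z : points_of_type t x -> X_ i y -> (d t <= \dim (spanE x))%N ->
    l \in t -> X_ l z -> wide y x l z ->
    (E y :&: (spanE x + E z) <= spanE x)%VS.
  move=> Hx Xy dx lt Xz wz.
  suff /eqP <- : (E y :&: spanE x == E y :&: (spanE x + E z))%VS by exact: capvSr.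
  rewrite eqEdim capvS ?addvSl //=.
  have dxz : (\dim (spanE x + E z) <= d (l :: t))%N.
    by rewrite addvC -spanE_cons general_dim_max.
  have dyx : (\dim (E y + spanE x) <= d (i :: t))%N.
    by rewrite -spanE_cons general_dim_max.
  have wz' : (d (i :: l :: t) <= \dim (E y + (spanE x + E z)))%N.
    by move: wz; rewrite /wide spanE_cons addvC addvA.
  have := dimv_sum_cap (E y) (spanE x + E z)%VS.
  have := dimv_sum_cap (E y) (spanE x).
  have := stall l lt; rewrite (dimE Xy); lia.
(* A general [u] also extends [y :: x1 ++ v :: x2] to maximal dimension. The joint span is symmetric
   in [u] and [v], so [cap], applied to the new sequence with the old point [v] as extension, keeps
   the old intersection inside the new span. *)
have good_replace t1 l t2 x1 v x2 y : t = t1 ++ l :: t2 ->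
    points_of_type t1 x1 -> X_ l v -> points_of_type t2 x2 -> X_ i y ->
    good (x1 ++ v :: x2) y ->
    gen l [set u | good (x1 ++ u :: x2) y /\
      (E y :&: spanE (x1 ++ v :: x2) <= spanE (x1 ++ u :: x2))%VS].
  move=> tE H1 Xv H2 Xy [dx wx].
  have lt : l \in t by rewrite tE mem_cat mem_head orbT.
  have g1 : gen l [set u | (d t <= \dim (spanE (x1 ++ u :: x2)))%N].
    have := @separately_open_dim t 0%VS (d t) _ _ _ _ _ _ tE H1 Xv H2.
    rewrite /= add0v => /(_ dx); apply: genS => u /=.
    by rewrite add0v.
  have g2 : gen l [set u | forall l', l' \in t ->
      exists2 z, X_ l' z & wide y (x1 ++ u :: x2) l' z].
    apply: gen_forall => l' /wx [z Xz wz].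
    have := @separately_open_dim t (E z + E y)%VS (d (i :: l' :: t)).
    move/(_ _ _ _ _ _ _ tE H1 Xv H2) => /=.
    rewrite -addvA -spanE_cons => /(_ wz); apply: genS => u /= wu.
    by exists z; rewrite // /wide spanE_cons addvA.
  have g3 : gen l [set u | wide y (x1 ++ v :: x2) l u].
    have [z Xz wz] := wx l lt.
    apply: genS (gen_dim (spanE (y :: x1 ++ v :: x2)) Xz) => u /=.
    by rewrite /wide [(E u + _)%VS]addvC; apply: leq_trans; rewrite addvC.
  apply: genS (genI (gen_self l) (gen_and3 g1 g2 g3)) => u [Xu [du wu wuv]].
  split=> //.
  have Hu : points_of_type t (x1 ++ u :: x2) by rewrite tE; apply: points_of_type_cat.
  have swap : (spanE (x1 ++ v :: x2) + E u = spanE (x1 ++ u :: x2) + E v)%VS.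
    by rewrite !spanE_replace -!addvA [(E u + E v)%VS]addvC.
  apply: subv_trans (cap _ _ _ _ Hu Xy du lt Xv _).
    by rewrite -swap capvS ?addvSl.
  rewrite /wide spanE_cons addvCA [(E v + _)%VS]addvC -swap.
  by rewrite [(_ + E u)%VS]addvC addvCA -spanE_cons.
(* Each requirement on [y :: x] is separately open and satisfiable for the word [i :: t], so all
   hold at a common sequence. In [B], [behead] removes [y]. *)
have [x0 [y0 [Hx0 Xy0 good0]]] : exists x y,
    [/\ points_of_type t x, X_ i y & good x y].
  pose B := [set z : seq W | (d t <= \dim (spanE (behead z)))%N].
  pose A l := [set z | exists2 v, X_ l v & (d (i :: l :: t) <= \dim (E v + spanE z))%N].
  have [||l lt|l lt|] := @separately_open_meet_all (i :: t) B t A.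
  - move=> [|i' t1] l t2 [|u x1] v x2 //= [_ tE] H1 Xv H2; rewrite /B /=.
      by move=> dx; apply: genS (gen_self l).
    case: H1 => _ H1 dx.
    have := @separately_open_dim t 0%VS (d t) _ _ _ _ _ _ tE H1 Xv H2.
    rewrite /= add0v => /(_ dx); apply: genS => w /=.
    by rewrite add0v.
  - have [x Hx dx] := general_dim_attained t.
    have [u Xu] := gen_ex (gen_self i).
    by exists (u :: x); rewrite // /B /= dx.
  - move=> t1 l' t2 x1 v x2 tE H1 Xv H2 [z Xz dz].
    apply: genS (@separately_open_dim _ (E z) _ _ _ _ _ _ _ tE H1 Xv H2 dz).
    by move=> u du; exists z.
  - have [[|y [|z x]] //] := general_dim_attained (i :: l :: t).
      by move=> [].
    move=> [Xy [Xz Hx]] dx; exists (y :: x) => //; exists z => //.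
    by rewrite -dx !spanE_cons addvCA.
  by move=> [|y x] [// [Xy Hx] Bx Ax]; exists x, y.
(* The group preserves [Q]. Hence the sum [U] of a sufficient finite family, which contains every
   subspace satisfying [Q], is a submodule. *)
pose Q (H : {vspace V}) := exists x y, [/\ points_of_type t x, X_ i y, good x y
  & (H <= E y :&: spanE x)%VS].
have [Hs QHs HsQ] := finitely_many_subspaces_suffice Q.
set U := (\sum_(H <- Hs) H)%VS in HsQ.
have U_stable g : (aV g @: U <= U)%VS.
  rewrite limg_sum; apply: subv_sum_seq => H /QHs [x [y [Hx Xy [dx wx] HH]]].
  apply: HsQ; exists (map (aW g) x), (aW g y); split.
  - exact: points_of_type_act.
  - exact: aW_stable.
  - split=> [|l lt]; first by rewrite (spanE_act g Hx) dim_limg.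
    have [z Xz wz] := wx l lt; exists (aW g z); first exact: aW_stable.
    by rewrite /wide spanE_cons (spanE_act g Hx) (aE g Xz) (aE g Xy)
      -!limgD dim_limg -spanE_cons.
  - rewrite (aE g Xy) (spanE_act g Hx); apply: subv_trans (limg_cap _ _ _).
    exact: limgS.
(* The case of zero [U] is impossible: [E y0 :&: spanE x0] lies in [U], and it is nonzero because
   the increment at [i] is less than [N i]. *)
have [U0|UV] := V_irreducible U_stable.
  have : (E y0 :&: spanE x0 <= U)%VS by apply: HsQ; exists x0, y0.
  rewrite U0 subv0 -dimv_eq0.
  have := dimv_sum_cap (E y0) (spanE x0); rewrite (dimE Xy0).
  have : (\dim (E y0 + spanE x0) <= d (i :: t))%N.
    by rewrite -spanE_cons general_dim_max.
  by case: good0 => ? _; lia.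
(* If [U] is the whole space, a single span containing every [H] in [Hs] contradicts [dV]. The
   points of [w] are chosen from left to right; each [H] keeps its own tail [x2] and its own [y],
   and one general point serves the finitely many [H] at once. *)
have [w Hw Uw] : exists2 w, points_of_type t w &
    forall H, H \in Hs -> (H <= spanE w)%VS.
  suff main t2 : forall t1 w, t = t1 ++ t2 -> points_of_type t1 w ->
      (forall H, H \in Hs -> exists x2 y, [/\ points_of_type t2 x2, X_ i y,
         good (w ++ x2) y & (H <= E y :&: spanE (w ++ x2))%VS]) ->
      exists2 w, points_of_type t w & forall H, H \in Hs -> (H <= spanE w)%VS.
    exact: (main t [::] [::]).
  elim: t2 => [|l t2 IH] t1 w tE Hw HsP.
    exists w => [|H /HsP [[|u x2] [y [] // _ _ _]]]; first by rewrite tE cats0.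
    by rewrite cats0 => /subv_trans; apply; apply: capvSr.
  have : gen l [set u | forall H, H \in Hs -> exists x2 y,
      [/\ points_of_type t2 x2, X_ i y, good (w ++ u :: x2) y
        & (H <= E y :&: spanE (w ++ u :: x2))%VS]].
    apply: gen_forall => H /HsP [[|v x2] [y [] //= [Xv H2] Xy gx HH]].
    apply: genS (good_replace _ _ _ _ _ _ _ tE Hw Xv H2 Xy gx) => u [gu Hu].
    exists x2, y; split=> //; rewrite subv_cap.
    by rewrite (subv_trans HH (capvSl _ _)) (subv_trans HH Hu).
  move/(genI (gen_self l))/gen_ex => [u [Xu Hu]].
  apply: (IH (rcons t1 l) (rcons w u)); rewrite ?cat_rcons //.
    by rewrite -!cats1; apply: points_of_type_cat.
  by move=> H /Hu [x2 [y Hy]]; exists x2, y; rewrite cat_rcons.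
have : (\dim {:V} <= d t)%N.
  rewrite -UV; apply: leq_trans (general_dim_max Hw); apply: dimvS.
  exact: subv_sum_seq.
by rewrite leqNgt dV.
Qed.

Variable Nmax : nat.
Hypothesis N_le : forall l, (N l <= Nmax)%N.

(** Each drop of the increment costs one more point, hence at most [Nmax] dimensions. If [\dim {:V}]
    exceeded the bound, the increment could be lowered to 0 and then once more, against
    [general_dim_cons_ge]. *)
Lemma small_increment_bound n t i : (d (i :: t) <= d t + n)%N -> (n < N i)%N ->
  (\dim {:V} <= d t + Nmax * n)%N.
Proof.
elim: n t => [|n IH] t dn nN; rewrite leqNgt; apply/negP => dV.
  have [||l _] := @increment_decreases t i; [lia | lia |].
  have := general_dim_cons_ge i (l :: t); lia.
have [||l _ dl] := @increment_decreases t i; [lia | lia |].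
have := IH (l :: t); have := general_dim_cons_le l t; have := N_le l.
lia.
Qed.

(** Points are added from the right end of the word. If a letter [i] added less than [N i]
    dimensions, [small_increment_bound] with [n] equal to [(N i).-1] would contradict the inequality
    assumed for the letters to its right. *)
Lemma general_dim_full t :
  (forall t1 i t2, t = t1 ++ i :: t2 -> (0 < N i)%N ->
    (\sum_(l <- t2) N l + Nmax * (N i).-1 < \dim {:V})%N) ->
  d t = (\sum_(l <- t) N l)%N.
Proof.
elim: t => [|i t IH] H.
  have [[|//] _ <-] := general_dim_attained [::].
  by rewrite /spanE !big_nil dimv0.
have dt : d t = (\sum_(l <- t) N l)%N.
  by apply: IH => t1 i' t2 tE; apply: (H (i :: t1)); rewrite tE.
rewrite big_cons -dt; have := general_dim_cons_le i t.
have := general_dim_cons_ge i t; have := @small_increment_bound (N i).-1 t i.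
have := H [::] i t erefl; rewrite -dt; lia.
Qed.

End IrreducibleModule.
End GeneralSpans.

(** * Generic properties on irreducible sets *)

Section Genericity.
Variables (K : fieldType) (W : vectType K).
Implicit Types (X Y P Q : set W).

(** On an irreducible [Y] every nonempty relatively open subset is dense, so nonemptiness is all
    that is asked. *)
Definition generic Y P : Prop :=
  exists2 O, zopen O & (Y `&` O) !=set0 /\ forall u, Y u -> O u -> P u.

Lemma generic_self Y : zirreducible Y -> generic Y Y.
Proof.
by move=> [[y Yy] _]; exists setT; [exact: zopenT | split=> //; exists y].
Qed.

Lemma generic_ex Y P : generic Y P -> exists u, P u.
Proof. by move=> [O _ [[u [Yu Ou]] H]]; exists u; apply: H. Qed.

Lemma genericS Y P Q : (forall u, P u -> Q u) -> generic Y P -> generic Y Q.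
Proof.
move=> PQ [O OO [YO H]]; exists O => //; split=> // u Yu Ou.
by apply: PQ; apply: H.
Qed.

(** Were [O1] and [O2] disjoint on [Y], their closed complements would cover [Y], and by
    irreducibility one of them would contain it. *)
Lemma genericI Y P Q : zirreducible Y ->
  generic Y P -> generic Y Q -> generic Y (P `&` Q).
Proof.
move=> [_ Yirr] [O1 OO1 [[u1 [Yu1 Ou1]] H1]] [O2 OO2 [[u2 [Yu2 Ou2]] H2]].
exists (O1 `&` O2); first exact: zopenI.
split; last by move=> u Yu [O1u O2u]; split; [apply: H1 | apply: H2].
apply: contrapT => nY.
have [u Yu|/(_ u1 Yu1)|/(_ u2 Yu2)] // := Yirr _ _ OO1 OO2.
have [O1u|] := pselect (O1 u); last by left.
have [O2u|] := pselect (O2 u); last by right.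
by case: nY; exists u.
Qed.

(** The Zariski closure [C] of [Y] meets [X] in an irreducible set, which equals [Y] by
    maximality. *)
Lemma component_relatively_closed X Y : irreducible_component X Y ->
  exists O, zopen O /\ forall u, X u -> (O u <-> ~ Y u).
Proof.
move=> [YX [Y0 Yirr] Ymax].
pose C := [set w : W | forall p, (forall y, Y y -> peval p y = 0) -> peval p w = 0].
have CC : zclosed C by exists [set p | forall y, Y y -> peval p y = 0].
have Cmin A : zclosed A -> Y `<=` A -> C `<=` A.
  move=> [J ->] YA w Cw p Jp; apply: Cw => y Yy.
  exact: (YA y Yy p Jp).
have YC : Y `<=` X `&` C.
  by move=> y Yy; split=> [|p py]; [exact: YX | exact: py].
have XC : X `&` C = Y.
  apply: Ymax => [||u []] //.
  split=> [|A B cA cB AB].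
    by case: Y0 => y Yy; exists y; apply: YC.
  have [u Yu|YA|YB] := Yirr A B cA cB; first by apply: AB; apply: YC.
    by left=> u [_ /Cmin]; apply.
  by right=> u [_ /Cmin]; apply.
exists (~` C); split; first by rewrite /zopen setCK.
by move=> u Xu; rewrite -XC; split=> [nC [_ /nC]|nXC Cu] //; apply: nXC; split.
Qed.

Lemma generic_dim (V : vectType K) X Y (E : W -> {vspace V}) (F : {vspace V}) v :
  embedded_bundle X E -> Y `<=` X -> Y v ->
  generic Y [set u | (\dim (F + E v) <= \dim (F + E u))%N].
Proof.
move=> EX YX Yv.
have [O [OO Ov H]] := dim_lower_semicontinuous
  (locally_spannedD (locally_spanned_cst X F v) (locally_spanned_bundle EX (YX v Yv))).
exists O => //; split; first by exists v.
by move=> u /YX; apply: H.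
Qed.

End Genericity.

(** * Component types of sequences of points *)

Section ComponentTypes.
Variables (K : fieldType) (W : vectType K) (k : nat).
Variables (X : set W) (X_ : 'I_k -> set W) (alpha N : 'I_k -> nat).
Local Notation r := (\sum_i alpha i)%N.
Implicit Types (x : {ffun 'I_r -> W}) (t : 'I_r -> 'I_k).

Definition has_type x t : Prop := forall j i, X_ i (x j) <-> i = t j.

(** Incidences are counted twice: each point lies in at most one component, and the prescribed
    cardinalities add up to the number of points, so each point lies in exactly one. *)
Lemma sequences_of_type_has_type x :
  sequences_of_type X X_ x -> exists t, has_type x t.
Proof.
move=> [_ xcard xuniq].
pose c j := #|[pred i | x j \in X_ i]|.
have c1 j : (c j <= 1)%N.
  by apply/card_le1_eqP => i i'; rewrite !inE => Xi Xi'; exact: xuniq Xi' Xi.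
have csum : (\sum_j c j = \sum_(j < r) 1)%N.
  rewrite [RHS]sum_nat_const card_ord muln1.
  under eq_bigr => j _ do rewrite /c -sum1_card big_mkcond /=.
  rewrite exchange_big /=; apply: eq_bigr => i _.
  by rewrite -(xcard i) -sum1_card [RHS]big_mkcond.
have c_eq1 j : c j = 1%N.
  have /eqP := csum; rewrite (leqif_sum (fun j _ => leqif_eq (c1 j))).2.
  by move=> /forallP/(_ j)/eqP.
have /choice[t tP] j : exists i, X_ i (x j).
  have : (0 < #|[pred i | x j \in X_ i]|)%N by rewrite -/(c j) c_eq1.
  by case/card_gt0P => i; rewrite !inE; exists i.
by exists t => j i; split=> [Xi|->] //; exact: xuniq Xi (tP j).
Qed.

Lemma has_type_card x t i : has_type x t ->
  #|[pred j | x j \in X_ i]| = #|[pred j | t j == i]|.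
Proof.
move=> xt; apply: eq_card => j; rewrite !inE.
by apply/idP/eqP => [|<-]; rewrite in_setE xt.
Qed.

Lemma sum_type x t (P : pred 'I_k) :
  sequences_of_type X X_ x -> has_type x t ->
  (\sum_(j | P (t j)) N (t j) = \sum_(i | P i) alpha i * N i)%N.
Proof.
move=> [_ xcard _] xt; rewrite (partition_big t P) //=; apply: eq_bigr => i Pi.
rewrite -(xcard i) (has_type_card i xt).
rewrite (eq_bigr (fun=> N i)) => [|j /andP[_ /eqP->] //].
rewrite sum_nat_const; congr (_ * _)%N; apply: eq_card => j; rewrite !inE /=.
by apply/andP/eqP => [[_ /eqP]|tji] //; rewrite tji Pi.
Qed.

End ComponentTypes.

(** * From general dimensions to nondefectivity, and the theorem *)

Section Main.
Variables (K : fieldType) (W V : vectType K) (k : nat) (X : set W).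
Variables (X_ : 'I_k -> set W) (E : W -> {vspace V}) (N alpha : 'I_k -> nat).
Hypothesis EX : embedded_bundle X E.
Hypothesis X_comp : irreducible_components X X_.
Hypothesis dimE : forall i x, X_ i x -> \dim (E x) = N i.
Local Notation r := (\sum_i alpha i)%N.
Local Notation d := (general_dim X_ E).
Implicit Types (x z : {ffun 'I_r -> W}).

Let X_component i : irreducible_component X (X_ i).
Proof. by have [_ H] := X_comp; apply/H; exists i. Qed.

Let X_irreducible i : zirreducible (X_ i).
Proof. by have [] := X_component i. Qed.

Let X_sub i : X_ i `<=` X.
Proof. by have [] := X_component i. Qed.

(** The locus where the span attains its upper bound [n] is relatively open by semicontinuity. For
    density, a sequence [z] in an open set is merged with one of maximal span; the result must also
    avoid the other components in order to have the right type. *)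
Lemma nondefective_of_general_dim :
  (forall z t, sequences_of_type X X_ z -> has_type X_ z t ->
     d [seq t j | j <- enum 'I_r] = (\sum_j N (t j))%N) ->
  nondefective X X_ alpha N E.
Proof.
move=> full; set n := (\sum_i alpha i * N i)%N.
pose S x := (\sum_j E (x j))%VS.
have sumN x t : sequences_of_type X X_ x -> has_type X_ x t ->
    (\sum_j N (t j) = n)%N.
  exact: (sum_type N xpredT).
have S_le x : sequences_of_type X X_ x -> (\dim (S x) <= n)%N.
  move=> sx; have [t xt] := sequences_of_type_has_type sx.
  rewrite -(sumN x t) //; apply: leq_trans (dimv_leq_sum _ _ _) _.
  by apply: leq_sum => j _; rewrite (dimE (i := t j)) //; apply/xt.
have eval_linear (j : 'I_r) : linear (fun x => x j).
  by move=> a x z; rewrite !ffunE.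
have gself l : generic (X_ l) (X_ l) by exact: generic_self.
have gex l (P : set W) : generic (X_ l) P -> exists u, P u by exact: generic_ex.
have gS l (P Q : set W) : (forall u, P u -> Q u) ->
  generic (X_ l) P -> generic (X_ l) Q by exact: genericS.
have gI l (P Q : set W) : generic (X_ l) P -> generic (X_ l) Q ->
  generic (X_ l) (P `&` Q) by exact: genericI.
have gdim l (F : {vspace V}) v : X_ l v ->
    generic (X_ l) [set u | (\dim (F + E v) <= \dim (F + E u))%N].
  by move=> Xv; apply: (generic_dim F EX) => //; exact: X_sub.
exists [set x | sequences_of_type X X_ x /\ \dim (S x) = n]; split; last first.
- by move=> x [].
- split=> [x []//|O OO [z [sz Oz]]].
  have [t zt] := sequences_of_type_has_type sz.
  pose tw := [seq t j | j <- enum 'I_r].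
  have tw_size : size tw = r by rewrite size_map size_enum_ord.
  have tw_nth (i0 : 'I_k) (j : 'I_r) : nth i0 tw j = t j.
    by rewrite (nth_map j) ?size_enum_ord // nth_ord_enum.
  (* The default 0 is never reached when [s] has length [r]. *)
  pose toff (s : seq W) : {ffun 'I_r -> W} := [ffun j => nth 0 s (val j)].
  have /choice[C CP] i := component_relatively_closed (X_component i).
  pose A := [set s | O (toff s) /\
    forall (j : 'I_r) i, i != t j -> C i (nth 0 s j)].
  pose B := [set s | (n <= \dim (0 + spanE E s))%N].
  have oA : separately_open X_ (fun l => generic (X_ l)) tw A.
    move=> t1 l t2 x1 v x2 tE H1 Xv H2 [Ov Cv].
    have sx1 := points_of_type_size H1.
    have jr : (size x1 < r)%N.
      by rewrite sx1 -tw_size tE size_cat /= addnS ltnS leq_addr.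
    pose j0 := Ordinal jr.
    have tj0 : t j0 = l by rewrite -(tw_nth l) tE nth_cat /= sx1 ltnn subnn.
    have nthR (u w : W) (j : 'I_r) : nth 0 (x1 ++ u :: x2) j =
        if j == j0 then u else nth 0 (x1 ++ w :: x2) j.
      rewrite !nth_cat; case: ltngtP => [jx|jx|jx].
      - by case: eqP jx => // ->; rewrite /= ltnn.
      - case: eqP jx => [->|_ jx]; first by rewrite /= ltnn.
        by rewrite -(subnSK jx).
      - by rewrite jx subnn (_ : j = j0) ?eqxx //; apply: val_inj.
    pose L u : {ffun 'I_r -> W} := [ffun j => if j == j0 then u else 0].
    have LL : linear L.
      move=> a u w; apply/ffunP => j; rewrite !ffunE.
      by case: ifP; rewrite ?scaler0 ?addr0.
    have toffE u : toff (x1 ++ u :: x2) = L u + toff (x1 ++ 0 :: x2).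
      apply/ffunP => j; rewrite !ffunE (nthR u 0) (nthR 0 v).
      by case: eqP => _; rewrite ?addr0 ?add0r // (nthR 0 v); case: eqP.
    (* Varying a single point is an affine map into the space of sequences, so the preimage of [O]
       is open. *)
    pose g u := L u + toff (x1 ++ 0 :: x2).
    exists (g @^-1` O `&` [set u | forall i, i \in enum 'I_k -> i != l -> C i u]).
      apply: zopenI; first exact: zopen_preimage (polymap_affine _ LL) OO.
      apply: (zopen_forall _ (F := fun i => [set u | i != l -> C i u])) => i.
      have [_|il] := boolP (i == l).
        by rewrite (_ : mkset _ = setT); [exact: zopenT | apply/seteqP; split].
      rewrite (_ : mkset _ = C i); first by case: (CP i).
      by apply/seteqP; split=> u; [apply | move=> Ciu _].
    split.
      exists v; split=> //; split=> [|i _ il]; first by rewrite /= /g -toffE.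
      by have := Cv j0 i; rewrite tj0 (nthR v 0) eqxx; apply.
    move=> u Xu [Ou Cu]; split=> [|j i]; first by rewrite /= toffE.
    rewrite (nthR u v); case: (j =P j0) => [->|_]; last exact: Cv.
    by rewrite tj0; apply: Cu; rewrite mem_enum.
  have oB : separately_open X_ (fun l => generic (X_ l)) tw B.
    exact: (separately_open_dim gS gdim).
  have Ha : points_of_type X_ tw [seq z j | j <- enum 'I_r].
    by apply: points_of_type_map => j; apply/zt.
  have a_nth (j : 'I_r) : nth 0 [seq z j | j <- enum 'I_r] j = z j.
    by rewrite (nth_map j) ?size_enum_ord // nth_ord_enum.
  have Aa : A [seq z j | j <- enum 'I_r].
    split=> [|j i ij].
      by rewrite (_ : toff _ = z) //; apply/ffunP => j; rewrite ffunE a_nth.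
    rewrite a_nth; have [_ H] := CP i; apply/H; first by case: sz.
    by move/zt => ijE; rewrite ijE eqxx in ij.
  have [b Hb db] := general_dim_attained E gself gex tw.
  have Bb : B b by rewrite /B /= add0v db (full z t) // (sumN z t).
  have [c [Hc [Oc Cc] Bc]] := separately_open_meet gself gex gS gI oA oB Ha Aa Hb Bb.
  have csize : size c = r by rewrite (points_of_type_size Hc).
  have cX (j : 'I_r) : X_ (t j) (nth 0 c j).
    have [_ H] := (points_of_typeP X_ tw c (t j) 0).1 Hc.
    by have := H j; rewrite tw_nth tw_size; apply.
  have ct : has_type X_ (toff c) t.
    move=> j i; rewrite ffunE; split=> [Xi|->]; last exact: cX.
    apply/eqP; apply: contrapT => /negP ij.
    have [_ H] := CP i; apply: (H (nth 0 c j) (X_sub (cX j))).1 Xi.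
    exact: Cc.
  have sc : sequences_of_type X X_ (toff c).
    split=> [j|i|j i i' /ct-> /ct->] //.
      by rewrite ffunE; apply: X_sub (cX j).
    rewrite (has_type_card i ct) -(has_type_card i zt).
    by case: sz.
  exists (toff c); split=> //; split=> //.
  apply/eqP; rewrite eqn_leq S_le //=.
  move: Bc; rewrite /B /= add0v /spanE (big_nth 0) csize big_mkord.
  by congr (_ <= \dim _)%N; apply: eq_bigr => j _; rewrite ffunE.
(* The required open set is the union of all open sets on which the span has dimension at least [n];
   semicontinuity puts every sequence with equality into one of them. *)
pose D := [set O | zopen O /\ forall u : {ffun 'I_r -> W},
  sequences_of_type X X_ u -> O u -> (n <= \dim (S u))%N].
exists (\bigcup_(O in D) O); first by apply: zopen_bigcup => O [].
apply/seteqP; split=> x [sx]; last first.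
  move=> [O [_ H] Ox]; split=> //; apply/eqP; rewrite eqn_leq S_le //=.
  exact: H.
move=> dx; split=> //.
have [O [OO Ox H]] : exists O, [/\ zopen O, O x &
    forall u, sequences_of_type X X_ u -> O u -> (\dim (S x) <= \dim (S u))%N].
  apply: dim_lower_semicontinuous; apply: locally_spanned_sum => j.
  apply: (locally_spanned_pullback (X := X) (polymap_linear (eval_linear j))).
    by move=> u [].
  by apply: locally_spanned_bundle => //; case: sx.
by exists O => //; split=> // u; rewrite -dx; exact: H.
Qed.

End Main.

(* Components are indexed by 'I_k.+1, the paper's X_1 being X_ ord0.
   Hypothesis hXi holds automatically when k = 0 and for connected algebraic
   groups; without it the conclusion is false: take X the union of the three
   coordinate axes of C^3 minus the origin, G the monomial matrices, E_x the
   line spanned by x, and alpha = (2, 0, 0). *)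
Theorem theorem3p3 (R : realType) (G : groupType) (W V : vectType R[i])
    (rhoW : G -> 'End(W)) (rhoV : G -> 'End(V))
    (hW : module_action rhoW) (hV : module_action rhoV)
    (hVirr : irreducible_module rhoV)
    (X : set W) (hX : quasi_affine_cone X) (hGX : stable_set rhoW X)
    (E : W -> {vspace V}) (hE : embedded_bundle X E)
    (hGE : invariant_bundle rhoW rhoV X E)
    (k : nat) (X_ : 'I_k.+1 -> set W) (hX_ : irreducible_components X X_)
    (hXi : forall i, stable_set rhoW (X_ i))
    (N : 'I_k.+1 -> nat) (hN : forall i x, X_ i x -> \dim (E x) = N i)
    (hNord : forall i j : 'I_k.+1, (i <= j)%N -> (N j <= N i)%N)
    (alpha : 'I_k.+1 -> nat)
    (halpha : forall i : 'I_k.+1,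
       ((\sum_(j < k.+1 | (j <= i)%N) alpha j * N j)%N%:Z
          + (N ord0)%:Z * ((N i)%:Z - 1) < (\dim {:V}%VS)%:Z)%R) :
  nondefective X X_ alpha N E.
Proof.
have Xi i : irreducible_component X (X_ i) by have [_ H] := hX_; apply/H; exists i.
have Xirr i : zirreducible (X_ i) by have [] := Xi i.
have XX i : X_ i `<=` X by have [] := Xi i.
apply: (nondefective_of_general_dim hE hX_ hN) => z t sz zt.
set tw := [seq t j | j <- enum 'I_(\sum_i alpha i)%N].
have sumtw (P : pred 'I_k.+1) :
    (\sum_(l <- tw | P l) N l = \sum_(l | P l) alpha l * N l)%N.
  by rewrite big_map big_enum_cond -(sum_type N P sz zt); apply: eq_bigl.
(* In the word sorted by decreasing index, only letters of index at most [i] stand to the right of a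
   letter [i]. Points with large fibers are thus added first, and the sums over suffixes are bounded
   by those in [halpha]. *)
pose ge_ord (i j : 'I_k.+1) := (j <= i)%N.
pose ts := sort ge_ord tw.
have tts : perm_eq ts tw by rewrite perm_sort.
have ts_sorted : sorted ge_ord ts.
  by apply: sort_sorted => i j; apply: leq_total.
have gself l := generic_self (Xirr l).
have gex l (P : set W) : generic (X_ l) P -> exists u, P u by exact: generic_ex.
have gS l (P Q : set W) : (forall u, P u -> Q u) ->
  generic (X_ l) P -> generic (X_ l) Q by exact: genericS.
have gI l (P Q : set W) : generic (X_ l) P -> generic (X_ l) Q ->
  generic (X_ l) (P `&` Q) by exact: genericI.
have gdim l (F : {vspace V}) v : X_ l v ->
    generic (X_ l) [set u | (\dim (F + E v) <= \dim (F + E u))%N].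
  by move=> Xv; apply: (generic_dim F hE) => //; exact: XX.
have Vinj g : lker (rhoV g) = 0%VS.
  have [h1 hM] := hV.
  apply/eqP/lker0P => u v uv.
  have K w : rhoV g^-1%g (rhoV g w) = w.
    by rewrite -comp_lfunE -hM mulVg h1 id_lfunE.
  by rewrite -(K u) uv K.
have EG g l u : X_ l u -> E (rhoW g u) = (rhoV g @: E u)%VS.
  by move=> /XX; apply: hGE.
have NN l : (N l <= N ord0)%N by apply: hNord.
have -> : (\sum_j N (t j) = \sum_(l <- ts) N l)%N.
  by rewrite (perm_big _ tts) big_map big_enum.
rewrite -(general_dim_perm E gself gex tts).
apply: (general_dim_full hN gself gex gS gI gdim Vinj (fun g l => @hXi l g) EG
  hVirr.2 NN) => t1 i t2 tsE Ni.
have le_i l : l \in t2 -> (l <= i)%N.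
  have : sorted ge_ord (i :: t2).
    by move: ts_sorted; rewrite tsE => /(subseq_sorted _); apply;
      [move=> a b c ab bc; exact: leq_trans bc ab | exact: suffix_subseq].
  move/(order_path_min _) => H lt; apply: (allP (H _) l lt).
  by move=> a b c ab bc; exact: leq_trans bc ab.
have sum_t2 : (\sum_(l <- t2) N l <= \sum_(l < k.+1 | (l <= i)%N) alpha l * N l)%N.
  rewrite -sumtw -(perm_big _ tts) tsE big_cat big_cons /= leqnn.
  rewrite [X in (_ <= _ + (_ + X))%N](_ : _ = \sum_(l <- t2) N l)%N.
    by rewrite addnA leq_addl.
  rewrite [LHS]big_seq_cond [RHS]big_seq; apply: eq_bigl => l.
  by case: (boolP (l \in t2)) => // /le_i ->.
(* As [N i] is positive here, the integer difference in [halpha] agrees with the truncated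
   predecessor. *)
have := halpha i; case Nm: (N i) Ni => [//|m] _ /=.
rewrite (_ : m.+1%:Z - 1 = m%:Z); last by rewrite -addn1 PoszD addrK.
rewrite -PoszM -PoszD ltz_nat; apply: leq_ltn_trans.
by rewrite leq_add2r.
Qed.
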